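(* Let $\mathfrak I$ be a testing ideal. Then the ideal-generated assignment $\Delta_{\mathfrak I}$ is a bidual assignment. Moreover, $\Delta_{\mathfrak I}$ satisfies the Semadeni condition.
   Context: Banach spaces are real, and $X$ is identified with its canonical image in $X^{**}$. A bidual assignment is a rule $\Delta$ assigning to each Banach space $X$ a closed linear subspace $X\subset\Delta(X)\subset X^{**}$ such that $T^{**}(\Delta(X))\subset\Delta(Y)$ for every bounded linear operator $T:X\to Y$. It satisfies the Semadeni condition if for every Banach space $X$, every weak$^*$-null sequence $(x_n^* )_n$ in $X^*$ and every $\Phi\in\Delta(X)$ one has $\Phi(x_n^* )\to0$. A testing ideal is a rule $\mathfrak I$ assigning to each Banach space $X$ an ideal $\mathfrak I(X^* )$ of subsets of $X^*$ (a family containing $\emptyset$, closed under subsets and finite unions) such that: (1) every countable subset of $X^*$ is in $\mathfrak I(X^* )$; (2) if $T:X\to Y$ is bounded linear and $A\in\mathfrak I(Y^* )$, then $T^*(A)\in\mathfrak I(X^* )$; (3) if $X,Y$ are Banach spaces, $A\in\mathfrak I(\mathcal L(X,Y^* ))$ (where $\mathcal L(X,Y^* )\cong(X\widehat\otimes_\pi Y)^*$, the dual of the projective tensor product) and $y^{**}\in\Delta_{\mathfrak I}(Y)$, then $\{y^{**}\circ T:T\in A\}\in\mathfrak I(X^* )$. Here $\Delta_{\mathfrak I}(X)$, the ideal-generated assignment, is the norm closure in $X^{**}$ of \[\Delta^0_{\mathfrak I}(X)=\{x^{**}\in X^{**}:\forall A\in\mathfrak I(X^* )\ \exists x\in X\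 \text{with}\ x^{**}|_A=x|_A\}.\] *)

(* Defs.v *)
From HB Require Import structures.
From mathcomp Require Import all_boot all_order all_algebra.
From mathcomp Require Import all_classical all_reals all_analysis.

Set Implicit Arguments.
Unset Strict Implicit.
Unset Printing Implicit Defensive.

Import Order.TTheory GRing.Theory Num.Theory.
Import numFieldNormedType.Exports.

Local Open Scope classical_set_scope.
Local Open Scope ring_scope.

Section BoundedLinear.
Context {R : realType} (X Y : normedModType R).

Definition bounded_linear : {pred X -> Y} := [pred f : X -> Y | `[<
  linear f /\ exists C : R, forall x, `|f x| <= C * `|x| >]].

Record blin := Blin {
  blin_fun :> X -> Y ;
  blinP : blin_fun \in bounded_linear }.

HB.instance Definition _ := [isSub for blin_fun].
HB.instance Definition _ := [Choice of blin by <:].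

Lemma bounded_linear_submod : submod_closed bounded_linear.
Proof.
split.
  apply/asboolP; split=> [a x y /=|]; first by rewrite scaler0 addr0.
  by exists 0 => x /=; rewrite normr0 mul0r.
move=> a f g /asboolP[lf [C fC]] /asboolP[lg [D gD]]; apply/asboolP; split.
  move=> b x y; rewrite -[LHS]/(a *: f _ + g _) -[RHS]/(_ *: (a *: f x + g x)
    + (a *: f y + g y)) lf lg !scalerDr !scalerA [a * b]mulrC.
  by rewrite addrACA.
exists (`|a| * C + D) => x; rewrite -[X in `|X|]/(a *: f x + g x).
rewrite (le_trans (ler_normD _ _))// mulrDl lerD// normrZ -mulrA.
exact: ler_wpM2l.
Qed.

HB.instance Definition _ :=
  GRing.isSubmodClosed.Build _ _ bounded_linear bounded_linear_submod.
HB.instance Definition _ := [SubChoice_isSubLmodule of blin by <:].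

Lemma blin_linear (f : blin) : linear f.
Proof. by have /asboolP[] := blinP f. Qed.

HB.instance Definition _ (f : blin) :=
  GRing.isLinear.Build R X Y *:%R f (blin_linear f).

Lemma blin_ext (f g : blin) : f =1 g -> f = g.
Proof. by move=> fg; apply/val_inj/funext. Qed.

Lemma blin0E x : (0 : blin) x = 0. Proof. by []. Qed.
Lemma blinDE (f g : blin) x : (f + g) x = f x + g x. Proof. by []. Qed.
Lemma blinZE a (f : blin) x : (a *: f) x = a *: f x. Proof. by []. Qed.
Lemma blinNE (f : blin) x : (- f) x = - f x. Proof. by []. Qed.

Lemma mk_blin_subproof (f : X -> Y) (C : R) :
  linear f -> (forall x, `|f x| <= C * `|x|) -> f \in bounded_linear.
Proof. by move=> lf fC; apply/asboolP; split=> //; exists C. Qed.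

Definition mk_blin f C (lf : linear f) (fC : forall x, `|f x| <= C * `|x|) :=
  Blin (mk_blin_subproof lf fC).

Definition opnorm (f : blin) : R := sup [set `|f x| | x in [set x | `|x| <= 1]].

Let ball_image_nonempty (f : blin) :
  [set `|f x| | x in [set x : X | `|x| <= 1]] !=set0.
Proof. by exists `|f 0|, 0 => //=; rewrite normr0. Qed.

Lemma opnorm_has_sup (f : blin) :
  has_sup [set `|f x| | x in [set x : X | `|x| <= 1]].
Proof.
split=> //; have /asboolP[_ [C fC]] := blinP f.
exists `|C| => _ [x /= x1 <-]; rewrite (le_trans (fC x))//.
rewrite (le_trans (ler_norm _))// normrM normr_id.
by rewrite ler_piMr.
Qed.

Lemma opnormP (f : blin) x : `|f x| <= opnorm f * `|x|.
Proof.
have [->|x0] := eqVneq x 0; first by rewrite linear0 !normr0 mulr0.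
rewrite -ler_pdivrMr ?normr_gt0//.
have -> : `|f x| / `|x| = `|f (`|x|^-1 *: x)|.
  by rewrite linearZ/= normrZ normfV normr_id mulrC.
apply: (sup_upper_bound (opnorm_has_sup f)).
exists (`|x|^-1 *: x) => //=.
by rewrite normrZ normfV normr_id mulVf// normr_eq0.
Qed.

Lemma opnorm_le (f : blin) C : 0 <= C -> (forall x, `|f x| <= C * `|x|) ->
  opnorm f <= C.
Proof.
move=> C0 fC; apply: ge_sup => // _ [x /= x1 <-].
by rewrite (le_trans (fC x))// ler_piMr.
Qed.

Lemma opnorm_ge0 (f : blin) : 0 <= opnorm f.
Proof.
apply: (le_trans (normr_ge0 (f 0))).
by apply: (sup_upper_bound (opnorm_has_sup f)); exists 0 => //=; rewrite normr0.
Qed.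

Lemma opnormD (f g : blin) : opnorm (f + g) <= opnorm f + opnorm g.
Proof.
apply: opnorm_le => [|x]; first by rewrite addr_ge0 ?opnorm_ge0.
by rewrite blinDE (le_trans (ler_normD _ _))// mulrDl lerD// opnormP.
Qed.

Let opnormZ_le a (f : blin) : opnorm (a *: f) <= `|a| * opnorm f.
Proof.
apply: opnorm_le => [|x]; first by rewrite mulr_ge0 ?opnorm_ge0.
by rewrite blinZE normrZ -mulrA ler_wpM2l// opnormP.
Qed.

Lemma opnormZ a (f : blin) : opnorm (a *: f) = `|a| * opnorm f.
Proof.
apply/eqP; rewrite eq_le opnormZ_le/=.
have [->|a0] := eqVneq a 0; first by rewrite normr0 mul0r opnorm_ge0.
rewrite -ler_pdivlMl ?normr_gt0// -normfV.
by rewrite -[X in opnorm X](scalerK a0) opnormZ_le.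
Qed.

Lemma opnorm_eq0 (f : blin) : opnorm f = 0 -> f = 0.
Proof.
move=> f0; apply: blin_ext => x; apply/normr0_eq0/le_anti.
by rewrite normr_ge0 andbT (le_trans (opnormP f x))// f0 mul0r.
Qed.

HB.instance Definition _ :=
  @Lmodule_isNormed.Build R blin opnorm opnormD opnormZ opnorm_eq0.

Lemma blin_norm_le (f : blin) x : `|f x| <= `|f| * `|x|.
Proof. exact: opnormP. Qed.

Lemma blin_norm_ub (f : blin) C : 0 <= C -> (forall x, `|f x| <= C * `|x|) ->
  `|f| <= C.
Proof. exact: opnorm_le. Qed.

End BoundedLinear.

Notation "{ 'blin' X -> Y }" := (blin X Y)
  (at level 0, X at level 98, Y at level 98, format "{ 'blin'  X  ->  Y }")
  : type_scope.

Section Composition.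
Context {R : realType} {X Y Z : normedModType R}.
Variables (g : {blin Y -> Z}) (f : {blin X -> Y}).

Let comp_linear : linear (g \o f).
Proof. by move=> a x y /=; rewrite !linearP. Qed.

Let comp_bound x : `|(g \o f) x| <= `|g| * `|f| * `|x|.
Proof.
by rewrite (le_trans (blin_norm_le _ _))// -mulrA ler_wpM2l// blin_norm_le.
Qed.

Definition blin_comp : {blin X -> Z} := mk_blin comp_linear comp_bound.

Lemma blin_compE x : blin_comp x = g (f x). Proof. by []. Qed.

Lemma blin_comp_norm : `|blin_comp| <= `|g| * `|f|.
Proof. by apply: blin_norm_ub => //; rewrite mulr_ge0. Qed.

End Composition.

Definition dual {R : realType} (X : normedModType R) : Type := {blin X -> R^o}.

HB.instance Definition _ (R : realType) (X : normedModType R) :=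
  NormedModule.copy (dual X) {blin X -> R^o}.

Section Adjoint.
Context {R : realType} {X Y : normedModType R} (T : {blin X -> Y}).

Let adjoint_fun (f : dual Y) : dual X := blin_comp f T.

Let adjoint_linear : linear adjoint_fun.
Proof. by move=> a f g; apply: blin_ext. Qed.

Let adjoint_bound f : `|adjoint_fun f| <= `|T| * `|f|.
Proof. by rewrite mulrC; exact: blin_comp_norm. Qed.

Definition adjoint : {blin dual Y -> dual X} :=
  mk_blin adjoint_linear adjoint_bound.

Lemma adjointE f x : adjoint f x = f (T x). Proof. by []. Qed.

End Adjoint.

Section CanonicalEmbedding.
Context {R : realType} {X : normedModType R} (x : X).

Let eval_fun (f : dual X) : R^o := f x.

Let eval_linear : linear eval_fun. Proof. by []. Qed.

Let eval_bound f : `|eval_fun f| <= `|x| * `|f|.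
Proof. by rewrite mulrC; exact: blin_norm_le. Qed.

Definition embed : dual (dual X) := mk_blin eval_linear eval_bound.

Lemma embedE f : embed f = f x. Proof. by []. Qed.

End CanonicalEmbedding.

Section Bilinear.
Context {R : realType}.

Definition bilinear_bounded_by (X Y Z : normedModType R) (C : R)
    (B : X -> Y -> Z) : Prop :=
  [/\ forall x, linear (B x),
      forall y, linear (B^~ y) &
      forall x y, `|B x y| <= C * `|x| * `|y|].

(* The pair (Z, tau) is a projective tensor product of X and Y, tau x y being
   the elementary tensor of x and y. The universal property with control of
   the norms determines (Z, tau) up to a unique isometric isomorphism. *)
Definition is_projective_tensor (X Y Z : completeNormedModType R)
    (tau : X -> Y -> Z) : Prop :=
  bilinear_bounded_by 1 tau /\
  forall (W : completeNormedModType R) (C : R) (B : X -> Y -> W),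
    0 <= C -> bilinear_bounded_by C B ->
    exists L : {blin Z -> W},
      [/\ forall x y, L (tau x y) = B x y,
          `|L| <= C &
          forall L' : {blin Z -> W},
            (forall x y, L' (tau x y) = B x y) -> L' = L].

End Bilinear.

Section Assignments.
Context (R : realType).

Definition closed_subspace (V : normedModType R) (D : set V) : Prop :=
  [/\ D 0, forall (a : R) u v, D u -> D v -> D (a *: u + v) & closed D].

Definition assignment : Type :=
  forall X : completeNormedModType R, set (dual (dual X)).

Definition bidual_assignment (Delta : assignment) : Prop :=
  [/\ forall X, closed_subspace (Delta X),
      forall (X : completeNormedModType R) (x : X), Delta X (embed x) &
      forall (X Y : completeNormedModType R) (T : {blin X -> Y}),
        adjoint (adjoint T) @` Delta X `<=` Delta Y].

Definition weakstar_null (X : completeNormedModType R) (f : nat -> dual X) :=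
  forall x, (fun n => f n x) @ \oo --> (0 : R).

Definition semadeni (Delta : assignment) : Prop :=
  forall (X : completeNormedModType R) (f : nat -> dual X),
    weakstar_null f ->
    forall Phi, Delta X Phi -> (fun n => Phi (f n)) @ \oo --> (0 : R).

Definition set_ideal (T : Type) (I : set (set T)) : Prop :=
  [/\ I set0,
      forall A B, B `<=` A -> I A -> I B &
      forall A B, I A -> I B -> I (A `|` B)].

Definition dual_families : Type :=
  forall X : completeNormedModType R, set (set (dual X)).

Definition ideal_generated0 (I : dual_families) : assignment := fun X =>
  [set Phi | forall A, I X A ->
     exists x : X, forall f, A f -> Phi f = embed x f].

Definition ideal_generated (I : dual_families) : assignment := fun X =>
  closure (ideal_generated0 I (X := X)).

(* A subset A of L(X, Y* ) is viewed as a subset of the dual of the projective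
   tensor product (Z, tau): T corresponds to the functional sending tau x y
   to T x y. *)
Definition tensor_dual_set (X Y Z : completeNormedModType R)
    (tau : X -> Y -> Z) (A : set {blin X -> dual Y}) : set (dual Z) :=
  [set f | exists2 T, A T & forall x y, f (tau x y) = T x y].

Definition testing_ideal (I : dual_families) : Prop :=
  [/\ forall X, set_ideal (I X),
      forall (X : completeNormedModType R) (A : set (dual X)),
        countable A -> I X A,
      forall (X Y : completeNormedModType R) (T : {blin X -> Y})
        (A : set (dual Y)), I Y A -> I X (adjoint T @` A) &
      forall (X Y Z : completeNormedModType R) (tau : X -> Y -> Z),
        is_projective_tensor tau ->
        forall (A : set {blin X -> dual Y}) (Phi : dual (dual Y)),
          I Z (tensor_dual_set tau A) -> ideal_generated I (X := Y) Phi ->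
          I X [set blin_comp Phi T | T in A]].

End Assignments.

Arguments ideal_generated0 {R} I X.
Arguments ideal_generated {R} I X.

(* Main.v *)
(* On a countable testing set a member of [ideal_generated0 I] agrees with a
   point of X, so it sends weak*-null sequences to 0; weak*-null sequences are
   norm bounded by Banach-Steinhaus, hence this persists in the norm closure.
   For functoriality, if Phi agrees with x on the set T^* A then T^** Phi agrees
   with T x on A. *)

Require Import Defs.
From mathcomp Require Import all_boot all_order all_algebra.
From mathcomp Require Import all_classical all_reals all_analysis.

Import Order.TTheory GRing.Theory Num.Theory.
Import numFieldNormedType.Exports.

Local Open Scope classical_set_scope.
Local Open Scope ring_scope.

Lemma closure_normP (R : realType) (V : normedModType R) (A : set V) (x : V) :
  closure A x <-> forall e : R, 0 < e -> exists2 y, A y & `|x - y| < e.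
Proof.
split=> [cAx e e0|dA B /nbhs_normP[e /= e0 eB]].
  have /cAx[y [Ay xy]] : nbhs x (ball x e) by exact: nbhsx_ballx.
  by exists y => //; rewrite -ball_normE in xy.
by have [y Ay xy] := dA _ e0; exists y; split=> //; exact: eB.
Qed.

(** Continuity of [T]. Applied to the second adjoint, it carries functoriality from
    [ideal_generated0] to its closure. *)
Lemma blin_image_closure (R : realType) (V W : normedModType R)
    (T : {blin V -> W}) (A : set V) (B : set W) :
  (forall v, A v -> B (T v)) -> forall v, closure A v -> closure B (T v).
Proof.
move=> AB v /closure_normP cAv; apply/closure_normP => e e0.
(* The summand 1 keeps the divisor positive when [T] is zero. *)
have N0 : 0 < `|T| + 1 by rewrite ltr_wpDl.
have [w Aw vw] := cAv (e / (`|T| + 1)) (divr_gt0 e0 N0).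
exists (T w); first exact: AB.
rewrite -linearB (le_lt_trans (blin_norm_le _ _))//.
rewrite (@le_lt_trans _ _ ((`|T| + 1) * `|v - w|))//.
  by rewrite ler_wpM2r// lerDl.
by rewrite mulrC -ltr_pdivlMr.
Qed.

Lemma closure_linear_closed (R : realType) (V : normedModType R) (D : set V) :
  (forall (a : R) u v, D u -> D v -> D (a *: u + v)) ->
  forall (a : R) u v, closure D u -> closure D v -> closure D (a *: u + v).
Proof.
move=> Dlin a u v /closure_normP cu /closure_normP cv.
apply/closure_normP => e e0.
have e20 : 0 < e / 2 by rewrite divr_gt0.
have N0 : 0 < `|a| + 1 by rewrite ltr_wpDl.
have [u' Du' uu'] := cu (e / 2 / (`|a| + 1)) (divr_gt0 e20 N0).
have [v' Dv' vv'] := cv (e / 2) e20.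
exists (a *: u' + v'); first exact: Dlin.
rewrite opprD addrACA -scalerBr [ltRHS](splitr e).
rewrite (le_lt_trans (ler_normD _ _))// ler_ltD// normrZ.
rewrite (@le_trans _ _ ((`|a| + 1) * `|u - u'|))//.
  by rewrite ler_wpM2r// lerDl.
by rewrite mulrC -ler_pdivlMr// ltW.
Qed.

Lemma weakstar_null_bounded (R : realType) (X : completeNormedModType R)
    (f : nat -> dual X) :
  weakstar_null f -> exists2 M : R, 0 < M & forall n, `|f n| <= M.
Proof.
move=> f0.
(* The radius 1 asks for a uniform bound on the unit ball, over which the dual norm is a supremum.
   Pointwise boundedness holds because each [f n x] converges. *)
have [g [n _ <-]|x|M fM] := @Banach_Steinhauss R X R^o
  [set (f n : X -> R^o) | n in setT] _ _ 1.
- split; last exact: blin_linear.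
  move=> r; exists (`|f n| * r) => x xr.
  by rewrite (le_trans (blin_norm_le _ _))// ler_wpM2l.
- have /cvg_seq_bounded[M [_ /(_ (M + 1))]] : cvgn (fun n => f n x : R^o).
    by apply/cvg_ex; exists 0; exact: f0.
  rewrite ltrDl ltr01 => /(_ isT) fM.
  by exists (M + 1) => _ [n _ <-]; exact: fM.
(* The sign of [M] is unknown; a strictly positive bound is needed because [semadeni_closure]
   divides by it. *)
exists (`|M| + 1) => [|n]; first by rewrite ltr_wpDl.
have M1 x : `|x| <= 1 -> `|f n x| <= M by move=> x1; apply: fM => //; exists n.
rewrite -[leLHS]/(opnorm (f n)) (@le_trans _ _ M)//.
  apply: ge_sup => [|_ [x /= x1 <-]]; last exact: M1.
  by exists `|f n 0|, 0 => //=; rewrite normr0.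
by rewrite (le_trans (ler_norm _))// lerDl.
Qed.

Section IdealGenerated0.
Context (R : realType) (I : dual_families R) (hI : testing_ideal I).

Lemma ideal_generated0_embed (X : completeNormedModType R) (x : X) :
  ideal_generated0 I X (embed x).
Proof. by move=> A _; exists x. Qed.

(** Both functionals are tested on the same set [A], so their representing points combine
    linearly. *)
Lemma ideal_generated0_linear_closed (X : completeNormedModType R) (a : R)
    (Phi Psi : dual (dual X)) :
  ideal_generated0 I X Phi -> ideal_generated0 I X Psi ->
  ideal_generated0 I X (a *: Phi + Psi).
Proof.
move=> DPhi DPsi A IA; have [x Phix] := DPhi _ IA.
have [y Psiy] := DPsi _ IA; exists (a *: x + y) => f Af.
by rewrite blinDE blinZE Phix// Psiy// !embedE linearP.
Qed.

Lemma ideal_generated0_adjoint (X Y : completeNormedModType R)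
    (T : {blin X -> Y}) (Phi : dual (dual X)) :
  ideal_generated0 I X Phi -> ideal_generated0 I Y (adjoint (adjoint T) Phi).
Proof.
have [_ _ Iadj _] := hI; move=> DPhi A /(Iadj _ _ T)/DPhi[x Phix].
by exists (T x) => f Af; rewrite adjointE Phix//; exists f.
Qed.

Lemma ideal_generated0_semadeni : semadeni (ideal_generated0 I).
Proof.
have [_ Icount _ _] := hI; move=> X f f0 Phi DPhi.
(* The range of a sequence is countable, hence a testing set, so one point [x] serves all [n] at
   once. *)
have [x Phix] : exists x : X, forall g, range f g -> Phi g = embed x g.
  by apply/DPhi/Icount/(sub_countable (card_image_le _ _)).
rewrite (_ : (fun n => Phi (f n)) = fun n => f n x)//.
by apply/funext => n; rewrite Phix//; exists n.
Qed.

End IdealGenerated0.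

Lemma semadeni_closure (R : realType) (Delta : assignment R) :
  semadeni Delta -> semadeni (fun X => closure (Delta X)).
Proof.
move=> sD X f f0 Phi /closure_normP cPhi.
have [M M0 fM] := weakstar_null_bounded _ _ _ f0.
apply/cvgr0Pnorm_lt => e e0; have e20 : 0 < e / 2 by rewrite divr_gt0.
(* With this distance, [Phi] and [Psi] differ by at most [e / 2] on every [f n], uniformly in [n];
   the other half comes from [Psi (f n)] tending to 0. *)
have [Psi DPsi PhiPsi] := cPhi (e / 2 / M) (divr_gt0 e20 M0).
have /cvgr0Pnorm_lt/(_ _ e20) := sD X f f0 Psi DPsi.
apply: filterS => n Psin.
rewrite -[Phi (f n)](subrK (Psi (f n))) (splitr e).
rewrite (le_lt_trans (ler_normD _ _))// ler_ltD//.
rewrite -[_ - _]/((Phi - Psi) (f n)) (le_trans (blin_norm_le _ _))//.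
by rewrite (le_trans (ler_wpM2l _ (fM n)))// -ler_pdivlMr// ltW.
Qed.

Theorem proposition4p5 (R : realType) (I : dual_families R)
    (hI : testing_ideal I) :
  bidual_assignment (ideal_generated I) /\ semadeni (ideal_generated I).
Proof.
split; last exact/semadeni_closure/ideal_generated0_semadeni.
split=> [X|X x|X Y T _ [Phi cPhi <-]].
- split; last exact: closed_closure.
    apply: subset_closure; rewrite (_ : 0 = embed 0).
      exact: ideal_generated0_embed.
    by apply: blin_ext => f; rewrite embedE linear0.
  exact/closure_linear_closed/ideal_generated0_linear_closed.
- exact/subset_closure/ideal_generated0_embed.
- by apply: blin_image_closure cPhi => Psi; exact: ideal_generated0_adjoint.
Qed.
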